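(* Let $A,B,H,Q\in\mathbb{R}^{n\times n}$, let $A=M-N$ with $M$ nonsingular, let $Q=Q_1-Q_2$ with $Q_1$ nonsingular, and let $\tau>0$ and $\theta>0$. Let $$a=\Vert M^{-1}N\Vert,\ c=\Vert M^{-1}BQ\Vert,\ d=\Vert Q_1^{-1}Q_2\Vert,\ \alpha=\Vert Q_1^{-1}\Vert,\ \beta=\Vert Q_1^{-1}H\Vert,$$ $$T=\begin{bmatrix} a & c\\ a(\theta\alpha+\beta)+\beta & c(\theta\alpha+\beta)+\theta d+|1-\theta|\end{bmatrix},\qquad T_{\rm RMS}=\begin{bmatrix}\Vert M^{-1}N\Vert & \Vert M^{-1}B\Vert\\ \tau\Vert M^{-1}N\Vert & |1-\tau|+\tau\Vert M^{-1}B\Vert\end{bmatrix}.$$ Assume that $$|1-\tau|\,\Vert M^{-1}N\Vert<1\quad\text{and}\quad \tau\Vert M^{-1}B\Vert<(1-\Vert M^{-1}N\Vert)(1-|1-\tau|),$$ and that $T$ is irreducible. If $$\Vert Q\Vert\le 1,\quad \beta c<|1-\tau|+\tau\Vert M^{-1}B\Vert+1,\quad \beta(a+1)<\tau a,\quad \alpha c+d<1,$$ $$(1-d)[\tau a-\beta(a+1)]>\alpha c(\tau a-\beta)+a\alpha\big[1-|1-\tau|-\tau\Vert M^{-1}B\Vert\big],$$ and $$\frac{1+\beta c-(|1-\tau|+\tau\Vert M^{-1}B\Vert)}{1-(\alpha c+d)}<\theta<\min\left\{\frac{|1-\tau|+\tau\Vert M^{-1}B\Vert+1-\beta c}{1+\alpha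 c+d},\ \frac{\tau a-(a+1)\beta}{a\alpha}\right\},$$ then $\rho(T)<\rho(T_{\rm RMS})<1$.
   Context: $\Vert\cdot\Vert$ is the matrix 2-norm and $\rho(\cdot)$ is the spectral radius. ''Irreducible'' is the usual notion for square (nonnegative) matrices. The matrices $T$ and $T_{\rm RMS}$ are the $2\times2$ nonnegative matrices bounding the norms of successive differences of the iterates of the GRMS method (with parameters $M,N,Q,Q_1,Q_2,H,\theta$) and of the RMS method (with splitting $A=M-N$ and relaxation parameter $\tau=\tau_{\rm RMS}$), respectively. *)

(* Defs.v *)
From mathcomp Require Import all_boot all_order all_algebra perm.
From mathcomp Require Import complex.
From mathcomp Require Import classical_sets reals.

Set Implicit Arguments.
Unset Strict Implicit.
Unset Printing Implicit Defensive.

Import Order.TTheory GRing.Theory Num.Theory.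
Local Open Scope classical_set_scope.
Local Open Scope ring_scope.

Definition vec2norm (R : realType) (n : nat) (x : 'cV[R]_n) : R :=
  Num.sqrt (\sum_(i < n) x i 0 ^+ 2).

(* The norm MathComp-Analysis puts on matrices is the entrywise sup norm, so the
   operator norm induced by the Euclidean norm is defined here. *)
Definition mx2norm (R : realType) (m n : nat) (A : 'M[R]_(m, n)) : R :=
  sup [set vec2norm (A *m x) | x in [set x : 'cV[R]_n | vec2norm x = 1]].

(* The eigenvalues of a real matrix are taken in R[i]. *)
Definition spectral_radius (R : realType) (n : nat) (A : 'M[R]_n) : R :=
  sup [set ComplexField.Normc.normc z |
       z in [set z : R[i] | eigenvalue (map_mx (real_complex R) A) z]].

(* A simultaneous permutation of rows and columns brings A to block upper
   triangular form, with nonempty diagonal blocks of sizes r and n - r. *)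
Definition reducible_mx (R : realType) (n : nat) (A : 'M[R]_n) : Prop :=
  exists (s : 'S_n) (r : nat), (0 < r < n)%N /\
    forall i j : 'I_n, (r <= i)%N -> (j < r)%N -> A (s i) (s j) = 0.

Definition irreducible_mx (R : realType) (n : nat) (A : 'M[R]_n) : Prop :=
  ~ reducible_mx A.

Definition mx22 (R : realType) (x y z w : R) : 'M[R]_2 :=
  \matrix_(i < 2, j < 2)
    if i == 0 then (if j == 0 then x else y) else (if j == 0 then z else w).

(* Main.v *)
Require Import Defs.
From mathcomp Require Import all_boot all_order all_algebra.
From mathcomp Require Import perm complex ring lra.
From mathcomp Require Import classical_sets reals.
Import Order.TTheory GRing.Theory Num.Theory.
Local Open Scope ring_scope.

(** Everything reduces to comparing two nonnegative 2 x 2 matrices with the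
same upper left entry a.  Such a matrix [x y; z w] has the real eigenvalues
(x + w +- sqrt ((x - w)^2 + 4 y z)) / 2, and the one with the plus sign is its
spectral radius (spectral_radius_mx22).

The hypotheses make T entrywise at most T_RMS.  Upper right: submultiplicativity
of the operator norm (mx2norm_mulmx) and ||Q|| <= 1 give c <= ||M^-1 B||.
Lower left: the bound theta < (tau a - (a + 1) beta) / (a alpha).  Lower right,
with strict inequality: the lower bound on theta when theta <= 1, and the bound
with denominator 1 + alpha c + d when theta > 1.  Let r be the spectral radius
of T.  Irreducibility makes both off-diagonal entries of T positive, so r > a;
strictly increasing w then makes the characteristic polynomial of T_RMS negative
at r, and r lies strictly below the larger root of that polynomial
(lt_spectral_radius_mx22).

For T_RMS, the determinant is a |1 - tau| < 1, and the second convergence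
hypothesis says that the characteristic polynomial is positive at 1.  The larger
root is therefore below 1: otherwise both roots would exceed 1, and so would
their product (spectral_radius_mx22_lt1). *)

(** * The operator 2-norm *)

Lemma vec2norm_ge0 (R : realType) (n : nat) (x : 'cV[R]_n) : 0 <= vec2norm x.
Proof. exact: sqrtr_ge0. Qed.

Lemma vec2normZ (R : realType) (n : nat) (k : R) (x : 'cV[R]_n) :
  vec2norm (k *: x) = `|k| * vec2norm x.
Proof.
rewrite /vec2norm -sqrtr_sqr -sqrtrM ?sqr_ge0// mulr_sumr.
by congr Num.sqrt; apply: eq_bigr => i _; rewrite mxE exprMn.
Qed.

Lemma ler_entry_vec2norm (R : realType) (n : nat) (x : 'cV[R]_n) (i : 'I_n) :
  `|x i 0| <= vec2norm x.
Proof.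
rewrite -sqrtr_sqr ler_wsqrtr// (bigD1 i)//= lerDl.
by apply: sumr_ge0 => j _; exact: sqr_ge0.
Qed.

Lemma vec2norm_eq0 (R : realType) (n : nat) (x : 'cV[R]_n) :
  vec2norm x = 0 -> x = 0.
Proof.
move=> x0; apply/colP => i; rewrite mxE; apply/eqP.
by rewrite -normr_le0 -x0 ler_entry_vec2norm.
Qed.

(** Entries of a unit vector have absolute value at most 1, so the absolute row
sums of A already bound the image of the unit sphere.  The bound is needed because
the supremum of an unbounded set is 0 by convention. *)
Lemma mx2norm_has_ubound (R : realType) (m n : nat) (A : 'M[R]_(m, n)) :
  has_ubound [set vec2norm (A *m x) | x in [set x : 'cV[R]_n | vec2norm x = 1]].
Proof.
exists (Num.sqrt (\sum_i (\sum_j `|A i j|) ^+ 2)) => _ [x /= x1 <-].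
apply/ler_wsqrtr/ler_sum => i _; rewrite -real_normK ?num_real//.
rewrite lerXn2r ?nnegrE// ?sumr_ge0// mxE (le_trans (ler_norm_sum _ _ _))//.
apply: ler_sum => j _; rewrite normrM ler_piMr//.
by rewrite -x1 ler_entry_vec2norm.
Qed.

(** Rescale x to the unit sphere, where the supremum bounds the image. *)
Lemma vec2norm_mulmx (R : realType) (m n : nat) (A : 'M[R]_(m, n))
    (x : 'cV[R]_n) : vec2norm (A *m x) <= mx2norm A * vec2norm x.
Proof.
have [x0|xN0] := eqVneq (vec2norm x) 0.
  by rewrite (vec2norm_eq0 _ _ _ x0) mulmx0 -(scale0r (0 : 'cV_m))
    -(scale0r (0 : 'cV_n)) !vec2normZ normr0 !mul0r mulr0.
have xgt0 : 0 < vec2norm x by rewrite lt_def xN0 vec2norm_ge0.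
have := ub_le_sup (mx2norm_has_ubound _ _ _ A).
move=> /(_ (vec2norm (A *m ((vec2norm x)^-1 *: x)))).
rewrite -scalemxAr vec2normZ ger0_norm ?invr_ge0 ?vec2norm_ge0//.
rewrite mulrC ler_pdivrMr//; apply.
exists ((vec2norm x)^-1 *: x) => /=.
  by rewrite vec2normZ ger0_norm ?invr_ge0 ?vec2norm_ge0// mulVf.
by rewrite -scalemxAr vec2normZ ger0_norm ?invr_ge0 ?vec2norm_ge0// mulrC.
Qed.

(** The unit sphere is empty in dimension 0; the supremum is then 0. *)
Lemma mx2norm_ge0 (R : realType) (m n : nat) (A : 'M[R]_(m, n)) :
  0 <= mx2norm A.
Proof.
rewrite /mx2norm; set S := (X in reals.sup X).
have [->|/set0P[y Sy]] := eqVneq S set0; first by rewrite sup0.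
apply: (@le_trans _ _ y); last exact: (ub_le_sup (mx2norm_has_ubound _ _ _ A)).
by case: Sy => x _ <-; exact: vec2norm_ge0.
Qed.

Lemma mx2norm_mulmx (R : realType) (m n p : nat) (A : 'M[R]_(m, n))
    (B : 'M[R]_(n, p)) : mx2norm (A *m B) <= mx2norm A * mx2norm B.
Proof.
rewrite {1}/mx2norm; set S := (X in reals.sup X).
have [->|/set0P S0] := eqVneq S set0.
  by rewrite sup0 mulr_ge0 ?mx2norm_ge0.
apply: ge_sup => // _ [x /= x1 <-]; rewrite -mulmxA.
apply: (le_trans (vec2norm_mulmx _ _ _ _ _)).
apply: ler_wpM2l; first exact: mx2norm_ge0.
by rewrite (le_trans (vec2norm_mulmx _ _ _ _ _))// x1 mulr1.
Qed.

(** * The spectral radius of a nonnegative 2 x 2 matrix *)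

Lemma horner_char_poly22 (R : comNzRingType) (A : 'M[R]_2) (t : R) :
  (char_poly A).[t] = (t - A 0 0) * (t - A 1 1) - A 0 1 * A 1 0.
Proof.
rewrite /char_poly (expand_det_row _ 0) !big_ord_recl big_ord0 /cofactor.
rewrite !det_mx11 !mxE /= !hornerE.
have -> : lift 0 0 = 1 :> 'I_2 by apply: val_inj.
have -> : lift 1 0 = 0 :> 'I_2 by apply: val_inj.
by rewrite /=; ring.
Qed.

(** The larger root of the characteristic polynomial; the other root is
x + w - perron_root22 x y z w. *)
Definition perron_root22 (R : rcfType) (x y z w : R) : R :=
  (x + w + Num.sqrt ((x - w) ^+ 2 + 4 * (y * z))) / 2.

Lemma perron_root22_eq (R : rcfType) (x y z w t : R) : 0 <= y * z ->
  (t - x) * (t - w) - y * z =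
  (t - perron_root22 R x y z w) * (t - (x + w - perron_root22 R x y z w)).
Proof.
move=> yz0; rewrite /perron_root22; set D := (X in Num.sqrt X).
have qE : Num.sqrt D ^+ 2 = D.
  by rewrite sqr_sqrtr// addr_ge0 ?sqr_ge0// mulr_ge0.
have -> : y * z = (Num.sqrt D ^+ 2 - (x - w) ^+ 2) / 4 by rewrite qE /D; field.
by field.
Qed.

Lemma perron_root22_ge (R : rcfType) (x y z w : R) :
  x + w <= 2 * perron_root22 R x y z w.
Proof.
rewrite /perron_root22; set q : R := Num.sqrt _.
have q0 : 0 <= q by exact: sqrtr_ge0.
lra.
Qed.

(** A monic quadratic is negative only strictly between its roots. *)
Lemma lt_perron_root22 (R : rcfType) (x y z w t : R) : 0 <= y * z ->
  (t - x) * (t - w) < y * z -> t < perron_root22 R x y z w.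
Proof.
move=> yz0; rewrite -subr_lt0 perron_root22_eq//.
have := perron_root22_ge R x y z w; set r := perron_root22 _ _ _ _ _ => r_ge.
by rewrite ltNge => h; rewrite ltNge; apply: contra h => rt; apply: mulr_ge0; lra.
Qed.

(** The trace is nonnegative, so the larger of the two real roots also has the
larger absolute value. *)
Lemma spectral_radius_mx22 (R : realType) (x y z w : R) :
  0 <= x -> 0 <= w -> 0 <= y * z ->
  spectral_radius (mx22 x y z w) = perron_root22 R x y z w.
Proof.
move=> x0 w0 yz0; set r := perron_root22 R x y z w.
have r_ge : x + w <= 2 * r by exact: perron_root22_ge.
have eigE (t : R[i]) : eigenvalue (map_mx (real_complex R) (mx22 x y z w)) t =
    (t == r%:C%C) || (t == (x + w - r)%:C%C).
  rewrite eigenvalue_root_char rootE horner_char_poly22 !mxE /=.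
  rewrite -!(rmorphM (real_complex R)).
  have xw : x + w = r + (x + w - r) by lra.
  have yzE : y * z = x * w - r * (x + w - r).
    by have := perron_root22_eq R x y z w 0 yz0; rewrite -/r; lra.
  rewrite yzE -[t == r%:C%C]subr_eq0 -[t == (_ - _)%:C%C]subr_eq0 -mulf_eq0.
  congr (_ == 0); rewrite !(rmorphB, rmorphD, rmorphM) /=; ring.
apply/le_anti/andP; split.
  apply: ge_sup.
    by exists (ComplexField.Normc.normc r%:C%C), r%:C%C; rewrite //= eigE eqxx.
  move=> _ [t /= + <-]; rewrite eigE => /orP[] /eqP -> /=;
    rewrite expr0n /= addr0 sqrtr_sqr ler_norml; apply/andP; split; lra.
have -> : r = ComplexField.Normc.normc r%:C%C.
  by rewrite /= expr0n /= addr0 sqrtr_sqr ger0_norm//; lra.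
apply: ub_le_sup; last by exists r%:C%C; rewrite //= eigE eqxx.
exists r => _ [t /= + <-]; rewrite eigE => /orP[] /eqP -> /=;
  rewrite expr0n /= addr0 sqrtr_sqr ler_norml; apply/andP; split; lra.
Qed.

(** A positive off-diagonal product puts the Perron root r of the first matrix
strictly above x, hence (r - x) (r - w') < (r - x) (r - w) = y z <= y' z': the
characteristic polynomial of the second matrix is negative at r. *)
Lemma lt_spectral_radius_mx22 (R : realType) (x y z w y' z' w' : R) :
  0 <= x -> 0 <= w -> 0 < y * z -> y * z <= y' * z' -> w < w' ->
  spectral_radius (mx22 x y z w) < spectral_radius (mx22 x y' z' w').
Proof.
move=> x0 w0 yz0 yz ww.
rewrite !spectral_radius_mx22 ?(le_trans w0 (ltW ww)) ?(le_trans (ltW yz0) yz)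
  ?(ltW yz0)//.
apply: lt_perron_root22; first by rewrite (le_trans (ltW yz0)).
have := perron_root22_eq R x y z w (perron_root22 R x y z w) (ltW yz0).
have := perron_root22_ge R x y z w; set r := perron_root22 _ _ _ _ _ => r_ge req.
have rx : 0 < r - x by rewrite ltNge; apply/negP => rx; nra.
have : (r - x) * (r - w') < (r - x) * (r - w) by rewrite ltr_pM2l//; lra.
lra.
Qed.

(** If the Perron root r were at least 1, positivity of the characteristic
polynomial at 1 would push both roots above 1, against the determinant, which
is their product. *)
Lemma spectral_radius_mx22_lt1 (R : realType) (x y z w : R) :
  0 <= x -> 0 <= w -> 0 <= y * z ->
  x * w - y * z < 1 -> 0 < (1 - x) * (1 - w) - y * z ->
  spectral_radius (mx22 x y z w) < 1.
Proof.
move=> x0 w0 yz0 det_lt1 p1; rewrite spectral_radius_mx22//.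
move: p1; rewrite perron_root22_eq//.
have := perron_root22_eq R x y z w 0 yz0.
set r := perron_root22 _ _ _ _ _; set r' := x + w - r => detE p1.
rewrite ltNge; apply/negP => r1; nra.
Qed.

(** A vanishing off-diagonal entry makes the matrix triangular, after exchange
of the two indices if it is the upper one. *)
Lemma irreducible_mx22 (R : realType) (x y z w : R) :
  irreducible_mx (mx22 x y z w) -> y != 0 /\ z != 0.
Proof.
move=> irr; split; apply/eqP => e0; apply: irr.
- exists (tperm 0 1), 1%N; split=> // i j.
  case: i => [[|[|//]] hi]; case: j => [[|[|//]] hj] //= _ _.
  have -> : Ordinal hi = 1 by apply: val_inj.
  have -> : Ordinal hj = 0 by apply: val_inj.
  by rewrite tpermL tpermR mxE.
- exists 1%g, 1%N; split=> // i j.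
  case: i => [[|[|//]] hi]; case: j => [[|[|//]] hj] //= _ _.
  by rewrite !permE mxE.
Qed.

(** * Comparison of the two methods *)

Theorem theorem2 (R : realType) (n : nat)
    (A B H Q M N Q1 Q2 : 'M[R]_n) (tau theta : R)
    (hA : A = M - N) (hM : M \in unitmx)
    (hQ : Q = Q1 - Q2) (hQ1 : Q1 \in unitmx)
    (htau : 0 < tau) (htheta : 0 < theta) :
  let a := mx2norm (invmx M *m N) in
  let b := mx2norm (invmx M *m B) in
  let c := mx2norm (invmx M *m B *m Q) in
  let d := mx2norm (invmx Q1 *m Q2) in
  let alpha := mx2norm (invmx Q1) in
  let beta := mx2norm (invmx Q1 *m H) in
  let T := mx22 a c
                (a * (theta * alpha + beta) + beta)
                (c * (theta * alpha + beta) + theta * d + `|1 - theta|) in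
  let TRMS := mx22 a b
                   (tau * a)
                   (`|1 - tau| + tau * b) in
  `|1 - tau| * a < 1 ->
  tau * b < (1 - a) * (1 - `|1 - tau|) ->
  irreducible_mx T ->
  mx2norm Q <= 1 ->
  beta * c < `|1 - tau| + tau * b + 1 ->
  beta * (a + 1) < tau * a ->
  alpha * c + d < 1 ->
  (1 - d) * (tau * a - beta * (a + 1)) >
    alpha * c * (tau * a - beta) + a * alpha * (1 - `|1 - tau| - tau * b) ->
  (1 + beta * c - (`|1 - tau| + tau * b)) / (1 - (alpha * c + d)) < theta ->
  theta < Num.min ((`|1 - tau| + tau * b + 1 - beta * c) / (1 + alpha * c + d))
                  ((tau * a - (a + 1) * beta) / (a * alpha)) ->
  spectral_radius T < spectral_radius TRMS /\ spectral_radius TRMS < 1.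
Proof.
move=> a b c d alpha beta T TRMS h_det h_p1 irrT hQ_le1 _ _ h_acd _ h_lo.
rewrite lt_min => /andP[h_up1 h_up2].
have a0 : 0 <= a by exact: mx2norm_ge0.
have b0 : 0 <= b by exact: mx2norm_ge0.
have c0 : 0 <= c by exact: mx2norm_ge0.
have d0 : 0 <= d by exact: mx2norm_ge0.
have alpha0 : 0 <= alpha by exact: mx2norm_ge0.
have beta0 : 0 <= beta by exact: mx2norm_ge0.
have s0 : 0 <= `|1 - tau| by [].
have ac0 : 0 <= alpha * c by exact: mulr_ge0.
have cb : c <= b.
  rewrite (le_trans (mx2norm_mulmx _ _ _ _ _ _))// ler_piMr//.
have [cN0 zN0] := irreducible_mx22 _ _ _ _ _ irrT.
have theta_alpha_beta0 : 0 <= theta * alpha + beta.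
  by rewrite addr_ge0// mulr_ge0// ltW.
split; last first.
  apply: spectral_radius_mx22_lt1; rewrite ?addr_ge0 ?mulr_ge0 ?(ltW htau)//; lra.
(* Division by 0 yields 0, so a alpha = 0 would turn the upper bound on theta
   into theta < 0. *)
have aalpha_gt0 : 0 < a * alpha.
  rewrite lt_def mulr_ge0// andbT; apply/eqP => aalpha0.
  by move: h_up2; rewrite aalpha0 invr0 mulr0 ltNge (ltW htheta).
apply: lt_spectral_radius_mx22 => //.
- by rewrite !addr_ge0 ?mulr_ge0 ?(ltW htheta).
- by rewrite lt_def mulf_neq0//= mulr_ge0// addr_ge0 ?mulr_ge0.
- apply: ler_pM => //; first by rewrite addr_ge0 ?mulr_ge0.
  by move: h_up2; rewrite ltr_pdivlMr//; lra.
(* The bound h_lo serves theta <= 1 and h_up1 serves theta > 1. *)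
- move: h_lo h_up1; rewrite ltr_pdivrMr ?ltr_pdivlMr; [|lra..].
  by case: (ger0P (1 - theta)) => _; lra.
Qed.
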